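(* Let $d\ge3$ and $\gamma\in\mathcal{P}_{\mathcal{W}_d}$. Then there exist a sequence $(\gamma_n^1)$ of discrete measures in $\mathcal{P}_{\mathcal{W}_d}$, a sequence $(\gamma_n^2)$ of singular measures without point masses in $\mathcal{P}_{\mathcal{W}_d}$, and a sequence $(\gamma_n^3)$ of absolutely continuous measures in $\mathcal{P}_{\mathcal{W}_d}$, each of which converges weakly to $\gamma$ on $[0,\infty)$.
   Context: $\mathcal{P}_{\mathcal{W}_d}$ is the set of probability measures $\gamma$ on $\mathcal{B}([0,\infty))$ with $\gamma(\{0\})=0$ and $\int_{[0,1]}(1-t)^{d-1}\,d\gamma(t)=1/2$. Singular and absolutely continuous are with respect to Lebesgue measure. *)

(* Defs.v *)
From HB Require Import structures.
From mathcomp Require Import all_boot all_order all_algebra.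
From mathcomp Require Import all_classical all_reals all_analysis.
Set Implicit Arguments. Unset Strict Implicit. Unset Printing Implicit Defensive.
Import Order.TTheory GRing.Theory Num.Theory.
Import numFieldNormedType.Exports.
Local Open Scope classical_set_scope.
Local Open Scope ring_scope.

(* Probability measures on B([0,oo)) are represented as probability measures
   on the Borel sets of R that give zero mass to ]-oo,0[. *)
Definition supported_on_nonneg (R : realType) (g : probability R R) : Prop :=
  g [set` `]-oo, 0[%classic] = 0%E.

Definition PWd (R : realType) (d : nat) (g : probability R R) : Prop :=
  [/\ supported_on_nonneg g,
      g [set 0] = 0%E &
      (\int[g]_(t in `[0%R, 1%R]) ((1 - t) ^+ d.-1)%R%:E = (2^-1)%R%:E)%E].

Definition discrete_measure (R : realType) (g : probability R R) : Prop :=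
  exists S : set R, [/\ countable S, measurable S & g (~` S) = 0%E].

Definition singular_measure (R : realType) (g : probability R R) : Prop :=
  exists N : set R, [/\ measurable N, (@lebesgue_measure R) N = 0%E & g (~` N) = 0%E].

Definition no_atoms (R : realType) (g : probability R R) : Prop :=
  forall x : R, g [set x] = 0%E.

Definition abs_continuous (R : realType) (g : probability R R) : Prop :=
  g `<< (@lebesgue_measure R).

Definition weak_cvg_nonneg (R : realType) (gs : nat -> probability R R)
    (g : probability R R) : Prop :=
  forall f : R -> R,
    {within `[(0:R), +oo[, continuous f} ->
    (exists M : R, forall x, 0 <= x -> `|f x| <= M) ->
    ((fun n => \int[gs n]_(x in `[0%R, +oo[%classic) (f x)%:E) @ \oo
      --> \int[g]_(x in `[0%R, +oo[%classic) (f x)%:E)%E.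

(* Main.v *)
Require Import Defs.
From HB Require Import structures.
From mathcomp Require Import all_boot all_order all_algebra.
From mathcomp Require Import all_classical all_reals all_analysis.
From mathcomp Require Import measurable_realfun lebesgue_integral_under.
From mathcomp Require Import zify lra ring.
Set Implicit Arguments. Unset Strict Implicit. Unset Printing Implicit Defensive.
Import Order.TTheory GRing.Theory Num.Theory.
Import numFieldNormedType.Exports.
Local Open Scope classical_set_scope.
Local Open Scope ring_scope.

(* Draw t from g and, independently, a jitter U in ]0, 1], and take the law of
   s (floor(n t) + U) / n.  It is a countable mixture of affine images of the
   law of U, so it is discrete, singular without atoms, or absolutely continuous
   as soon as U is constant, has a Cantor-like law, or is uniform.  As n tends to
   infinity and s to 1 it converges weakly to g by dominated convergence.  Since
   the integral of the weight (1 - c t)_+^(d-1) against g is strictly decreasing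
   in c near 1, for large n the intermediate value theorem provides s arbitrarily
   close to 1 at which the moment constraint holds exactly; the jitter being
   positive, no mass is put at 0. *)

(** * Random grid points and their law *)

Section grid_law.
Variables (R : realType) (U : {mfun R >-> R}) (n : nat) (s : R).

Definition grid_point (z : R * R) : R :=
  s * (((Num.truncn (n%:R * z.1))%:R + U z.2) / n%:R).

Lemma measurable_grid_point : measurable_fun [set: R * R] grid_point.
Proof.
have mt : measurable_fun [set: R] (fun t : R => (Num.truncn (n%:R * t))%:R : R).
  apply: nondecreasing_measurable => // x y xy.
  by rewrite ler_nat le_truncn// ler_wpM2l.
apply: measurable_funM => //; apply: measurable_funM => //.
apply: measurable_funD; first exact: measurableT_comp mt measurable_fst.
exact: measurableT_comp measurable_snd.
Qed.

HB.instance Definition _ := isMeasurableFun.Build _ _ _ _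
  grid_point measurable_grid_point.

Definition grid_law (g P : probability R R) : probability R R :=
  distribution (g \x P)%E grid_point.

End grid_law.
Arguments grid_point {R}.
Arguments grid_law {R}.

(** * Convergence of grid laws as the mesh tends to zero *)

Section bounded_continuous.
Variables (R : realType).

Lemma bounded_integrable d (T : measurableType d) (P : probability T R)
    (f : T -> R) (M : R) :
  measurable_fun setT f -> (forall x, `|f x| <= M) ->
  P.-integrable setT (EFin \o f).
Proof.
move=> mf fM; apply: (@le_integrable _ _ _ _ _ _ _ (cst M%:E)) => //.
- exact/measurable_EFinP.
- by move=> x _ /=; rewrite lee_fin (le_trans (fM x))// ler_norm.
- exact: finite_measure_integrable_cst.
Qed.

(** Rounding down loses less than one cell and the jitter adds at most one, so before scaling by [s]
    the error is at most the mesh. [Num.truncn] is [0] on negative reals, hence the positive part in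
    the limit. *)
Lemma grid_point_cvg (U : {mfun R >-> R}) (n : nat -> nat) (s : nat -> R) (c : R)
    (z : R * R) :
  (forall x, 0 < U x <= 1) -> (forall m, (m < n m)%N) -> s @ \oo --> c ->
  grid_point U (n m) (s m) z @[m --> \oo] --> c * Num.max z.1 0.
Proof.
move=> U01 mn sc; apply: cvgM => //.
have n0 m : 0 < (n m)%:R :> R by rewrite ltr0n (leq_trans _ (mn m)).
apply/cvgrPdist_le => e e0; near=> m.
have me : (n m)%:R^-1 <= e.
  apply: (@le_trans _ _ (m.+1%:R^-1)); first by rewrite lef_pV2 ?posrE// ler_nat.
  by apply: ltW; near: m; exact: near_infty_natSinv_lt (PosNum e0).
apply: le_trans me.
have [/andP[U0 U1]] := (U01 z.2).
rewrite -[leRHS]mul1r ler_pdivlMr// -(gtr0_norm (n0 m)) -normrM (gtr0_norm (n0 m)).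
rewrite mulrBl divfK ?gt_eqF//.
have [z0|z0] := leP 0 z.1.
  have /andP[] := truncn_itv (mulr_ge0 (ltW (n0 m)) z0).
  rewrite -natr1 mulrC; set k := (_%:R : R); rewrite mulrC ler_norml => ? ?.
  by apply/andP; split; lra.
have -> : Num.truncn ((n m)%:R * z.1) = 0%N.
  apply/eqP; rewrite -leqn0 truncn_le_nat (le_lt_trans _ ltr01)//.
  by rewrite mulr_ge0_le0// ltW.
by rewrite mul0r sub0r normrN add0r ger0_norm// ltW.
Unshelve. all: by end_near. Qed.

(** On the fixed product space the grid points converge pointwise, and the constant [M] dominates.
    The limit scale [c] stays general: [c = 1] serves weak convergence, [c] near [1] serves the
    moments. *)
Lemma cvg_integral_grid_law (g P : probability R R) (U : {mfun R >-> R})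
    (n : nat -> nat) (s : nat -> R) (c : R) (f : R -> R) (M : R) :
  (forall x, 0 < U x <= 1) -> (forall m, (m < n m)%N) -> s @ \oo --> c ->
  continuous f -> (forall x, `|f x| <= M) ->
  (\int[grid_law U (n m) (s m) g P]_x (f x)%:E @[m --> \oo] -->
     \int[g]_x (f (c * Num.max x 0))%:E)%E.
Proof.
move=> U01 mn sc cf fM.
have mf : measurable_fun setT f by exact: continuous_measurable_fun.
have mh : measurable_fun setT (fun x : R => f (c * Num.max x 0)).
  apply: measurableT_comp => //; apply: measurable_funM => //.
  exact: measurable_maxr.
have mF : measurable_fun [set: R * R] (fun z => f (c * Num.max z.1 0)).
  exact: measurableT_comp mh measurable_fst.
have -> : (\int[g]_x (f (c * Num.max x 0))%:E =
           \int[(g \x P)%E]_z (f (c * Num.max z.1 0))%:E)%E.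
  rewrite -integral12_prod_meas1 /=; last by apply: bounded_integrable => // z; exact: fM.
  by apply: eq_integral => x _; rewrite /fubini_F/= integral_cst//= probability_setT mule1.
under eq_fun.
  move=> m; rewrite integral_distribution.
  over.
  - exact/measurable_EFinP.
  - apply: (@bounded_integrable _ _ _ (f \o grid_point U (n m) (s m)) M).
    + exact: measurableT_comp.
    + by move=> z; exact: fM.
apply: (@dominated_cvg _ _ _ _ _ _ _ _ (EFin \o cst M)) => //.
- by move=> m; apply/measurable_EFinP; exact: measurableT_comp.
- move=> z _; apply: cvg_EFin; first by apply: nearW.
  apply: continuous_cvg; first exact: cf.
  exact: grid_point_cvg.
- exact: (@bounded_integrable _ _ _ (cst M) `|M|).
- by move=> m z _; rewrite /= lee_fin.
Qed.

End bounded_continuous.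

(** Extends a test function on the half-line to a continuous one on the whole line, constant on the
    negative side. *)
Lemma continuous_comp_max0 (R : realType) (f : R -> R) :
  {within `[0, +oo[, continuous f} -> continuous (fun x : R => f (Num.max x 0)).
Proof.
move=> /subspace_continuousP cf x; have A : [set` `[0, +oo[] (Num.max x 0).
  by rewrite /= in_itv/= andbT le_max lexx orbT.
apply: cvg_comp (cf _ A) => P; rewrite /within/= /nbhs/= => nP.
have cm : (fun y : R => Num.max y 0) y @[y --> x] --> Num.max x 0.
  by apply: (@continuous_max R R id (cst 0) x); [exact: cvg_id|exact: cvg_cst].
apply: (@filterS _ (nbhs x) _ _ _ _ (cm _ nP)) => y /=; apply.
by rewrite /= in_itv/= andbT le_max lexx orbT.
Qed.

(** * The moment weight *)

Section weight.
Variables (R : realType) (d : nat).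

(* [(1 - t)^d] on [[0, 1]], extended by constants so as to be bounded and continuous
   on the whole line. *)
Definition weight (t : R) : R := Num.min 1 (Num.max 0 (1 - t)) ^+ d.

Lemma weight_ge0 t : 0 <= weight t.
Proof. by rewrite exprn_ge0// le_min ler01 le_max lexx. Qed.

Lemma weight_le1 t : weight t <= 1.
Proof. by rewrite exprn_ile1 ?ge_min ?lexx// le_min ler01 le_max lexx. Qed.

Lemma normr_weight_le1 t : `|weight t| <= 1.
Proof. by rewrite ger0_norm ?weight_ge0// weight_le1. Qed.

Lemma continuous_weight : continuous weight.
Proof.
move=> x.
apply: (@continuous_comp R R R (fun y => Num.min 1 (Num.max 0 (1 - y)))
  (fun y => y ^+ d)); last exact: exprn_continuous.
apply: (@continuous_min R R (cst 1) (fun y => Num.max 0 (1 - y)) x).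
  exact: cvg_cst.
apply: (@continuous_max R R (cst 0) (fun y => 1 - y) x); first exact: cvg_cst.
by apply: cvgB; [exact: cvg_cst|exact: cvg_id].
Qed.

Lemma weightE t : 0 <= t <= 1 -> weight t = (1 - t) ^+ d.
Proof.
by move=> /andP[t0 t1]; rewrite /weight max_r ?subr_ge0// min_r// gerBl.
Qed.

Lemma weight_eq0 t : (0 < d)%N -> 1 <= t -> weight t = 0.
Proof.
by move=> d0 t1; rewrite /weight max_l ?subr_le0// min_r// expr0n gtn_eqF.
Qed.

Lemma weight_max0 t : weight (Num.max t 0) = weight t.
Proof.
have [//|t0] := leP 0 t.
by rewrite /weight subr0 (max_r ler01) minxx max_r ?min_l//; lra.
Qed.

Lemma weight_decr s t : s <= t -> weight t <= weight s.
Proof.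
move=> st; rewrite lerXn2r ?nnegrE ?le_min ?ler01 ?le_max ?lexx//.
by rewrite /Order.min /Order.max; repeat case: ifPn; lra.
Qed.

Lemma weight_lt s t : (0 < d)%N -> 0 <= s -> s < 1 -> s < t -> weight t < weight s.
Proof.
move=> d0 s0 s1 st; rewrite ltrXn2r -?lt0n ?nnegrE ?le_min ?ler01 ?le_max ?lexx//.
by rewrite /Order.min /Order.max; repeat case: ifPn; lra.
Qed.

End weight.

(** * Integration against measures carried by the half-line *)

Section supported.
Variables (R : realType) (g : probability R R).
Hypothesis g0 : supported_on_nonneg g.

Lemma supported_integral (h : R -> R) (M : R) :
  measurable_fun setT h -> (forall x, `|h x| <= M) ->
  (\int[g]_(x in `[0%R, +oo[%classic) (h x)%:E = \int[g]_x (h x)%:E)%E.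
Proof.
move=> mh hM; apply/esym.
rewrite (@negligible_integral _ _ _ g setT `]-oo, 0[%classic)//; first last.
- by move: g0; rewrite /supported_on_nonneg set_mem_set.
- exact: bounded_integrable hM.
congr (integral _ _ _); apply/seteqP; split => x /=; rewrite !in_itv/= andbT.
  by move=> [_ /negP]; rewrite -leNgt.
by move=> x0; split => //; apply/negP; rewrite -leNgt.
Qed.

Lemma supported_integral_max0 (f : R -> R) (M : R) :
  measurable_fun setT (fun x : R => f (Num.max x 0)) ->
  (forall x, 0 <= x -> `|f x| <= M) ->
  (\int[g]_(x in `[0%R, +oo[%classic) (f x)%:E =
     \int[g]_x (f (Num.max x 0))%:E)%E.
Proof.
move=> mf fM; rewrite -(supported_integral (M := M))//; last first.
  by move=> x; rewrite fM// le_max lexx orbT.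
by apply: eq_integral => x; rewrite inE/= in_itv/= andbT => x0; rewrite max_l.
Qed.

(** The negative half-line is null, and beyond [1] the weight vanishes because the exponent is
    positive. *)
Lemma supported_integral_weight d : (0 < d)%N ->
  (\int[g]_(t in `[0%R, 1%R]) ((1 - t) ^+ d)%R%:E = \int[g]_t (weight d t)%:E)%E.
Proof.
move=> d0; rewrite -(supported_integral (M := 1)); last 2 first.
- by apply: continuous_measurable_fun; exact: continuous_weight.
- exact: normr_weight_le1.
rewrite [LHS]integral_mkcond [RHS]integral_mkcond.
apply: eq_integral => t _; rewrite !patchE !mem_setE !in_itv/= andbT.
have [t0|t0]//= := leP 0 t.
have [t1|t1] := leP t 1; first by rewrite weightE// t0 t1.
by rewrite weight_eq0// ltW.
Qed.

End supported.

(** * Moments under dilation *)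

Section scaled_weight.
Variables (R : realType) (g : probability R R) (d : nat).
Hypothesis d0 : (0 < d)%N.

Definition scaled_weight (c : R) : R := \int[g]_x weight d (c * Num.max x 0).

Let mw c : measurable_fun setT (fun x : R => weight d (c * Num.max x 0)).
Proof.
apply: (measurableT_comp (continuous_measurable_fun (@continuous_weight R d))).
by apply: measurable_funM => //; exact: measurable_maxr.
Qed.

Let iw c : g.-integrable setT (EFin \o (fun x : R => weight d (c * Num.max x 0))).
Proof.
by apply: (@bounded_integrable _ _ _ _ _ 1) => // x; exact: normr_weight_le1.
Qed.

Lemma scaled_weightE c :
  (\int[g]_x (weight d (c * Num.max x 0))%:E = (scaled_weight c)%:E)%E.
Proof. by rewrite /scaled_weight /Rintegral fineK//; apply: integrable_fin_num => //; exact: iw. Qed.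

(** The integrands are ordered pointwise, so equal integrals would make them equal almost
    everywhere. For [x] in []0, 1[] they differ, since [a * x < 1] lies where the weight is strictly
    decreasing; but []0, 1[] has positive mass. *)
Lemma scaled_weight_lt (a b : R) :
  0 < a -> a <= 1 -> a < b -> g `]0%R, 1%R[%classic != 0%E ->
  scaled_weight b < scaled_weight a.
Proof.
move=> a0 a1 ab g01.
have wab x : weight d (b * Num.max x 0) <= weight d (a * Num.max x 0).
  by rewrite weight_decr// ler_wpM2r ?le_max ?lexx ?orbT// ltW.
rewrite lt_neqAle; apply/andP; split; last first.
  by apply: le_Rintegral => //; exact: iw.
apply: contra g01 => /eqP Hab.
have : (\int[g]_x `|(weight d (a * Num.max x 0) - weight d (b * Num.max x 0))%:E| = 0)%E.
  under eq_integral do rewrite abse_EFin ger0_norm ?subr_ge0// EFinB.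
  by rewrite integralB_EFin//; [rewrite !scaled_weightE Hab subee|exact: iw..].
move/ae_eq_integral_abs => /= H.
have [|N [mN N0 subN]] := H measurableT.
  by apply/measurable_EFinP; exact: measurable_funB.
apply/eqP; apply: subset_measure0 N0 => // x /=; rewrite in_itv/= => /andP[x0 x1].
apply: subN => /=; apply/not_implyP; split => // -[] /eqP.
rewrite subr_eq0 max_l ?ltW// gt_eqF// weight_lt//.
- by rewrite mulr_ge0 ?ltW.
- by rewrite (le_lt_trans _ x1)// ler_piMl// ltW.
- by rewrite ltr_pM2r.
Qed.

End scaled_weight.

Section PWd_weight.
Variables (R : realType) (g : probability R R) (d : nat).
Hypotheses (d1 : (1 < d)%N) (gW : PWd d g).

Let d0 : (0 < d.-1)%N. Proof. by case: d d1 => [//|[]]. Qed.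

Lemma PWd_scaled_weight1 : scaled_weight g d.-1 1 = 2^-1.
Proof.
case: gW => g0 _; rewrite supported_integral_weight// => gint.
apply: EFin_inj; rewrite -scaled_weightE// -gint.
by apply: eq_integral => x _; rewrite mul1r weight_max0.
Qed.

(** The integrand vanishes at [1] and [{0}] is null, so without mass on []0, 1[] the moment would be
    [0] instead of [2^-1]. *)
Lemma PWd_itv01_neq0 : g `]0%R, 1%R[%classic != 0%E.
Proof.
apply/eqP => g01; case: gW => _ g00.
have -> : (\int[g]_(t in `[0%R, 1%R]) ((1 - t) ^+ d.-1)%:E =
           \int[g]_(t in `[0%R, 1%R]) (0%R)%:E)%E.
  apply: ae_eq_integral => //.
    apply/measurable_EFinP/measurable_funTS; apply: measurable_funX.
    exact: measurable_funB.
  exists (`]0%R, 1%R[ `|` [set 0%R]); split => //=.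
  - exact: measurableU.
  - by apply: null_set_setU => //; exact: measurable_set1.
  move=> x /= /not_implyP[]; rewrite !in_itv/= => /andP[x0 x1] xne.
  have [->|xn0] := eqVneq x 0; first by right.
  left; rewrite lt_neqAle eq_sym xn0 x0/= lt_neqAle x1 andbT.
  by apply/eqP => x1'; apply: xne; rewrite x1' subrr expr0n gtn_eqF.
rewrite integral0 => -[] /esym/eqP; rewrite invr_eq0.
by rewrite pnatr_eq0.
Qed.

End PWd_weight.

(** * Grid laws satisfying the moment constraint *)

Section grid_approximation.
Variables (R : realType) (g P : probability R R) (U : {mfun R >-> R}).
Hypothesis U01 : forall x, 0 < U x <= 1.

Lemma grid_point_gt0 n s z : (0 < n)%N -> 0 < s -> 0 < grid_point U n s z.
Proof.
move=> n0 s0; rewrite mulr_gt0// divr_gt0 ?ltr0n// ltr_wpDl//.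
by case/andP: (U01 z.2).
Qed.

(** A positive jitter makes every grid point positive; this yields both the support condition and
    the absence of mass at [0]. *)
Lemma grid_law_nonpos n s (A : set R) : (0 < n)%N -> 0 < s ->
  (forall x, A x -> x <= 0) -> grid_law U n s g P A = 0%E.
Proof.
move=> n0 s0 A0; rewrite /grid_law /= /distribution /pushforward /=.
rewrite (_ : _ @^-1` _ = set0) ?measure0//.
by apply/seteqP; split => // z /= /A0; rewrite leNgt grid_point_gt0.
Qed.

Lemma supported_grid_law n s : (0 < n)%N -> 0 < s ->
  supported_on_nonneg (grid_law U n s g P).
Proof.
move=> n0 s0; apply: grid_law_nonpos => // x; rewrite set_mem_set/= in_itv/=.
exact: ltW.
Qed.

Variable d : nat.

(** The moment of the grid law, written over a measure independent of [s] so that continuity in [s]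
    follows by domination. *)
Definition grid_weight n s : R :=
  \int[(g \x P)%E]_z weight d (grid_point U n s z).

Let mw n s : measurable_fun setT (fun z => weight d (grid_point U n s z)).
Proof.
exact: (measurableT_comp (continuous_measurable_fun (@continuous_weight R d))).
Qed.

Let iw n s : (g \x P)%E.-integrable setT
  (EFin \o (fun z => weight d (grid_point U n s z))).
Proof.
by apply: (@bounded_integrable _ _ _ _ _ 1) => // x; exact: normr_weight_le1.
Qed.

Lemma grid_weightE n s :
  (\int[grid_law U n s g P]_x (weight d x)%:E = (grid_weight n s)%:E)%E.
Proof.
rewrite /grid_law integral_distribution.
- by rewrite /grid_weight /Rintegral fineK//; apply: integrable_fin_num => //; exact: iw.
- apply/measurable_EFinP; apply: continuous_measurable_fun.
  exact: continuous_weight.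
- exact: iw.
Qed.

Lemma continuous_grid_weight n : continuous (grid_weight n).
Proof.
move=> s; apply: (@continuity_under_integral _ _ _ (g \x P)%E
  (fun s z => weight d (grid_point U n s z)) setT measurableT (s - 1) (s + 1) _ _
  (cst 1)).
- by move=> x _; exact: iw.
- apply: aeW => z _ x _; apply: (@continuous_comp R R R (fun s => grid_point U n s z) (weight d) x);
    last exact: continuous_weight.
  by apply: cvgM; [exact: cvg_id|exact: cvg_cst].
- by apply: (@bounded_integrable _ _ _ _ (cst 1) 1) => // x; rewrite normr1.
- by move=> x _; apply: aeW => z _; exact: normr_weight_le1.
- by rewrite inE/= in_itv/=; apply/andP; split; lra.
Qed.

Lemma cvg_grid_weight c : grid_weight m.+1 c @[m --> \oo] --> scaled_weight g d c.
Proof.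
have : (\int[grid_law U m.+1 c g P]_x (weight d x)%:E @[m --> \oo] -->
    (scaled_weight g d c)%:E)%E.
  rewrite -scaled_weightE.
  apply: (@cvg_integral_grid_law R g P U succn (cst c)) => //.
  - exact: cvg_cst.
  - exact: continuous_weight.
  - exact: normr_weight_le1.
move/fine_cvg; under eq_fun do rewrite /= grid_weightE.
by [].
Qed.

End grid_approximation.

Section PWd_approximation.
Variables (R : realType) (g P : probability R R) (U : {mfun R >-> R}) (d : nat).
Hypotheses (U01 : forall x, 0 < U x <= 1) (d1 : (1 < d)%N) (gW : PWd d g).

Let d0 : (0 < d.-1)%N. Proof. by case: d d1 => [//|[]]. Qed.

Lemma exists_grid_weight_eq (m : nat) : exists ns : nat * R,
  [/\ (m < ns.1)%N, 0 < ns.2, `|ns.2 - 1| <= m.+2%:R^-1 &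
      grid_weight g P U d.-1 ns.1 ns.2 = 2^-1].
Proof.
(* With [m.+2] rather than [m.+1], [e < 1] holds even for [m = 0], so the whole interval
   [[1 - e, 1 + e]] consists of positive scales. *)
set e : R := m.+2%:R^-1.
have e0 : 0 < e by rewrite invr_gt0.
have e1 : e < 1 by rewrite invf_lt1// ltr1n.
have g01 := PWd_itv01_neq0 d1 gW.
have Hlt : scaled_weight g d.-1 (1 + e) < 2^-1.
  by rewrite -(PWd_scaled_weight1 d1 gW); apply: scaled_weight_lt => //; lra.
have Hgt : 2^-1 < scaled_weight g d.-1 (1 - e).
  by rewrite -(PWd_scaled_weight1 d1 gW); apply: scaled_weight_lt => //; lra.
near \oo => k.
have nlt : grid_weight g P U d.-1 k.+1 (1 + e) < 2^-1.
  by near: k; apply: cvgr_lt Hlt; exact: cvg_grid_weight.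
have ngt : 2^-1 < grid_weight g P U d.-1 k.+1 (1 - e).
  by near: k; apply: cvgr_gt Hgt; exact: cvg_grid_weight.
have mk : (m < k.+1)%N by rewrite ltnS; near: k; exact: nbhs_infty_ge.
have [|||s sI sE] := @IVT R (grid_weight g P U d.-1 k.+1) (1 - e) (1 + e) 2^-1.
- lra.
- by apply: continuous_subspaceT; exact: continuous_grid_weight.
- by rewrite ge_min le_max (ltW nlt) (ltW ngt) orbT.
exists (k.+1, s); split => //=; move: sI; rewrite in_itv/= => /andP[s0 s1]; first lra.
by rewrite ler_norml; apply/andP; split; lra.
Unshelve. all: by end_near. Qed.

Lemma PWd_grid_law n s : (0 < n)%N -> 0 < s ->
  grid_weight g P U d.-1 n s = 2^-1 -> PWd d (grid_law U n s g P).
Proof.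
move=> n0 s0 nsE; have supp := supported_grid_law g P U01 n0 s0.
split => //; first by apply: grid_law_nonpos => // x ->.
by rewrite supported_integral_weight// grid_weightE nsE.
Qed.

Lemma grid_law_approximation : exists ns : nat -> nat * R,
  [/\ forall m, (0 < (ns m).1)%N, forall m, 0 < (ns m).2,
      forall m, PWd d (grid_law U (ns m).1 (ns m).2 g P) &
      weak_cvg_nonneg (fun m => grid_law U (ns m).1 (ns m).2 g P) g].
Proof.
have [ns nsP] := choice exists_grid_weight_eq.
have n0 m : (0 < (ns m).1)%N by case: (nsP m) => [/(leq_ltn_trans (leq0n _))].
have s0 m : 0 < (ns m).2 by case: (nsP m).
exists ns; split => //; first by move=> m; apply: PWd_grid_law => //; case: (nsP m).
move=> f cf [M fM].
have ch := continuous_comp_max0 cf.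
have hM (x : R) : `|f (Num.max x 0)| <= M by rewrite fM// le_max lexx orbT.
have mh : measurable_fun setT (fun x : R => f (Num.max x 0)).
  exact: continuous_measurable_fun.
have [g0 _ _] := gW.
rewrite (supported_integral_max0 g0 mh fM).
under eq_fun do rewrite (supported_integral_max0 (supported_grid_law _ _ _ _ _) mh fM)//.
(* Inserting the scale [1] and a second positive part matches the limit in [cvg_integral_grid_law]
   at [c = 1]. *)
have -> : (\int[g]_x (f (Num.max x 0))%:E =
           \int[g]_x ((fun y => f (Num.max y 0)) (1 * Num.max x 0))%:E)%E.
  apply: eq_integral => x _; congr (f _)%:E; rewrite mul1r.
  by rewrite [RHS]max_l// le_max lexx orbT.
apply: cvg_integral_grid_law ch hM => //; first by move=> m; case: (nsP m).
apply/cvgrPdist_le => e e0; near=> m; rewrite distrC.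
have [_ _ /le_trans + _] := nsP m; apply.
apply: (@le_trans _ _ m.+1%:R^-1); first by rewrite lef_pV2 ?posrE// ler_nat.
by apply: ltW; near: m; exact: near_infty_natSinv_lt (PosNum e0).
Unshelve. all: by end_near. Qed.

End PWd_approximation.

(** * Null sets of grid laws *)

Section grid_law_null.
Variables (R : realType) (g P : probability R R) (U : {mfun R >-> R}).

(** By Fubini: once [t] is fixed, only the cell index [k] of [t] matters, and the inner integral is
    the [P]-mass of one affine preimage. *)
Lemma grid_law_null (n : nat) (s : R) (A : set R) : measurable A ->
  (forall k : nat, P [set u | A (s * ((k%:R + U u) / n%:R))] = 0%E) ->
  grid_law U n s g P A = 0%E.
Proof.
move=> mA A0; rewrite /grid_law /= /distribution /pushforward /= /product_measure1.
apply: integral0_eq => t _ /=.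
rewrite -(A0 (Num.truncn (n%:R * t))); congr (P _).
by apply/seteqP; split => u /=; rewrite /xsection/= inE.
Qed.

End grid_law_null.

Section affine_null.
Variable R : realType.

(** The pushforward of Lebesgue measure by the affine map, multiplied by [b], has the right value on
    half-open intervals, so it is Lebesgue measure by uniqueness. *)
Lemma lebesgue_measure_affine_preimage (a b : R) (A : set R) :
  0 < b -> measurable A -> (@lebesgue_measure R) A = 0%E ->
  (@lebesgue_measure R) ((fun u => a + b * u) @^-1` A) = 0%E.
Proof.
move=> b0 mA A0; pose phi (u : measurableTypeR R) : measurableTypeR R := a + b * u.
have mphi : measurable_fun setT phi by apply: measurable_funD => //; exact: measurable_funM.
pose scaled : {measure set (measurableTypeR R) -> \bar R} :=
  mscale (NngNum (ltW b0)) (pushforward (@lebesgue_measure R) phi).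
pose mu := scaled mphi.
suff: lebesgue_measure A = mu A.
  rewrite A0 => /esym/eqP; rewrite /mu /scaled /mscale /= mule_eq0 eqe gt_eqF//= => /eqP.
  exact.
apply: lebesgue_measure_unique => // _ [[x y] _ <-]/=.
rewrite /mu /scaled /mscale /= /pushforward.
have -> : phi @^-1` `]x, y]%classic = `](x - a) / b, (y - a) / b]%classic.
  apply/seteqP; split => u /=; rewrite !in_itv/= ltr_pdivrMr// ler_pdivlMr// ltrBlDl lerBrDl;
    by rewrite ![u * b]mulrC.
rewrite !lebesgue_measure_itv/= !lte_fin ltr_pM2r ?invr_gt0// ltrD2r.
case: ifPn => _; last by rewrite mule0.
by rewrite -!EFinB -EFinM; congr (_%:E); field; rewrite gt_eqF.
Qed.

End affine_null.

(** * The uniform law on the unit interval *)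

Section uniform01.
Variable R : realType.

(* The library's uniform law lives on [measurableTypeR R]; the identity carries it
   over to the measurable structure of [R] itself. *)
Definition to_real (u : measurableTypeR R) : R := u.

Let measurable_to_real : measurable_fun setT to_real.
Proof. by move=> _ A mA; rewrite setTI. Qed.

HB.instance Definition _ := isMeasurableFun.Build _ _ _ _
  to_real measurable_to_real.

Definition uniform01 : probability R R :=
  distribution (uniform_prob (@ltr01 R)) to_real.

Lemma uniform01E (A : set R) : uniform01 A = uniform_prob (@ltr01 R) A.
Proof. by []. Qed.

(** The uniform law is dominated by Lebesgue measure and does not charge the complement of [[0, 1]],
    so only the part of [S] inside [[0, 1]] counts. *)
Lemma uniform01_null (S N : set R) :
  measurable S -> measurable N -> (@lebesgue_measure R) N = 0%E ->
  (forall u, 0 <= u <= 1 -> S u -> N u) -> uniform01 S = 0%E.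
Proof.
move=> mS mN N0 SN.
have PN : uniform01 N = 0%E.
  rewrite uniform01E.
  by have /null_content_dominatesP := dominates_uniform_prob (@ltr01 R); apply.
have PC : uniform01 (~` `[0%R, 1%R]) = 0%E.
  rewrite probability_setC// [X in (1 - X)%E](_ : _ = 1%E) ?subee//.
  exact: integral_uniform_pdf1.
have PNC : uniform01 (N `|` ~` `[0%R, 1%R]) = 0%E.
  by apply: null_set_setU => //; exact: measurableC.
apply: subset_measure0 PNC => //.
  by apply: measurableU => //; exact: measurableC.
move=> u Su; have [u01|u01] := boolP (0 <= u <= 1); first by left; exact: SN.
by right; rewrite /= in_itv/=; exact/negP.
Qed.

(** Jitters must respect their bounds at every real; clipping ensures this without altering them on
    [[0, 1]], which carries [uniform01]. *)
Definition clip01 (u : R) : R := Num.max 0 (Num.min u 1).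

Lemma clip01_itv u : 0 <= clip01 u <= 1.
Proof. by rewrite le_max lexx/= ge_max ler01 ge_min lexx orbT. Qed.

Lemma clip01_id u : 0 <= u <= 1 -> clip01 u = u.
Proof. by move=> /andP[u0 u1]; rewrite /clip01 min_l// max_r. Qed.

Lemma clip01_le : {homo clip01 : u v / u <= v}.
Proof.
by move=> u v uv; rewrite /clip01 /Order.min /Order.max; repeat case: ifPn; lra.
Qed.

End uniform01.

(* Moves the [n] lowest binary digits of [m] to base 4; the undigested head stays a
   single digit, so that no bound on [m] is needed. *)
Fixpoint spread (n m : nat) : nat :=
  if n is n'.+1 then (4 * spread n' m./2 + odd m)%N else m.

(** Either the halves are strictly ordered, and the gain of [4] outweighs the last digit, or they
    agree and the last digit decides. *)
Lemma spread_lt n : {homo spread n : m m' / (m < m')%N}.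
Proof.
elim: n => [//|n IH] m m' mm' /=.
have : (m./2 < m'./2)%N \/ m./2 = m'./2 /\ (odd m < odd m')%N by lia.
move=> [/IH|[->]]; first by case: (odd m); case: (odd m'); lia.
by case: (odd m); case: (odd m'); lia.
Qed.

Lemma spread_le n : {homo spread n : m m' / (m <= m')%N}.
Proof.
by move=> m m'; rewrite leq_eqVlt => /predU1P[->//|/(spread_lt n)/ltnW].
Qed.

(** * The digit-spreading function: strictly increasing, with null image *)

Section digit_spreading.
Variable R : realType.
Implicit Types x y : R.

Lemma truncn_double x : 0 <= x -> (Num.truncn (2 * x))./2 = Num.truncn x.
Proof.
move=> x0; have /andP[t1 t2] := truncn_itv x0.
have A : (2 * Num.truncn x <= Num.truncn (2 * x))%N.
  by rewrite truncn_ge_nat ?mulr_ge0// natrM ler_wpM2l.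
have B : (Num.truncn (2 * x) < 2 * (Num.truncn x).+1)%N.
  by rewrite truncn_lt_nat ?mulr_ge0// natrM ltr_pM2l.
lia.
Qed.

Definition digits n x : nat := spread n (Num.truncn (2 ^+ n * x)).

Lemma digitsS n x : 0 <= x ->
  exists b : bool, digits n.+1 x = (4 * digits n x + b)%N.
Proof.
move=> x0; exists (odd (Num.truncn (2 ^+ n.+1 * x))).
by rewrite /digits /= exprS -mulrA truncn_double// mulr_ge0// exprn_ge0.
Qed.

(** Nested enclosures of the limit. Later base-4 digits are [0] or [1] and add at most a third of a
    unit of level [n], so the slack [2^-1] in [digits_hi] suffices; being below [1], it keeps
    enclosures of distinct digit strings disjoint. *)
Definition digits_lo n x : R := (digits n x)%:R / 4 ^+ n.
Definition digits_hi n x : R := ((digits n x)%:R + 2^-1) / 4 ^+ n.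

Lemma digits_lo_nd x : 0 <= x -> nondecreasing_seq (digits_lo ^~ x).
Proof.
move=> x0; apply/nondecreasing_seqP => n; rewrite /digits_lo exprS.
have [b ->] := digitsS n x0; have q0 : 0 < 4 ^+ n :> R by exact: exprn_gt0.
have -> : (4 * digits n x + b)%:R / (4 * 4 ^+ n) =
    (digits n x)%:R / 4 ^+ n + b%:R / (4 * 4 ^+ n) :> R.
  by rewrite natrD natrM; field; rewrite gt_eqF.
by rewrite lerDl divr_ge0// mulr_ge0// ltW.
Qed.

Lemma digits_hi_ni x : 0 <= x -> nonincreasing_seq (digits_hi ^~ x).
Proof.
move=> x0; apply/nonincreasing_seqP => n; rewrite /digits_hi exprS.
have [b ->] := digitsS n x0; have q0 : 0 < 4 ^+ n :> R by exact: exprn_gt0.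
have -> : ((4 * digits n x + b)%:R + 2^-1) / (4 * 4 ^+ n) =
    ((digits n x)%:R + 2^-1) / 4 ^+ n - (3 / 2 - b%:R) / (4 * 4 ^+ n) :> R.
  by rewrite natrD natrM; field; rewrite gt_eqF.
rewrite gerBl divr_ge0 ?mulr_ge0 ?(ltW q0)// subr_ge0.
by case: b => /=; lra.
Qed.

Lemma digits_lo_hi i j x : 0 <= x -> digits_lo i x <= digits_hi j x.
Proof.
move=> x0; apply: (le_trans (digits_lo_nd x0 (leq_maxl i j))).
apply: le_trans (digits_hi_ni x0 (leq_maxr i j)).
by rewrite ler_pM2r ?invr_gt0 ?exprn_gt0// lerDl.
Qed.

(* The binary expansion of [x] reread in base 4: at level [n] the image of [[0, 1]]
   meets about [2 ^ n] intervals of length at most [4 ^- n], hence is null. *)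
Definition digit_spread x : R := sup (range (digits_lo ^~ x)).

Lemma digit_spread_lo n x : 0 <= x -> digits_lo n x <= digit_spread x.
Proof.
move=> x0; apply: ub_le_sup; last by exists n.
by exists (digits_hi 0 x) => _ [i _ <-]; exact: digits_lo_hi.
Qed.

Lemma digit_spread_hi n x : 0 <= x -> digit_spread x <= digits_hi n x.
Proof.
move=> x0; apply: ge_sup; first by exists (digits_lo 0 x); exists 0%N.
by move=> _ [i _ <-]; exact: digits_lo_hi.
Qed.

Lemma digit_spread_le x y : 0 <= x -> x <= y -> digit_spread x <= digit_spread y.
Proof.
move=> x0 xy; apply: ge_sup; first by exists (digits_lo 0 x); exists 0%N.
move=> _ [i _ <-]; apply: le_trans (digit_spread_lo i (le_trans x0 xy)).
rewrite ler_pM2r ?invr_gt0 ?exprn_gt0// ler_nat.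
by apply: spread_le; rewrite le_truncn// ler_wpM2l// exprn_ge0.
Qed.

(** At a level where [x] and [y] have different truncations their enclosures are disjoint. *)
Lemma digit_spread_lt x y : 0 <= x -> x < y -> digit_spread x < digit_spread y.
Proof.
move=> x0 xy; have y0 := le_trans x0 (ltW xy).
have yx0 : 0 < y - x by rewrite subr_gt0.
(* Then [(y - x)^-1 < n.+1 <= 2 ^+ n.+1]. *)
pose n := Num.truncn (y - x)^-1.
have yx : 1 <= 2 ^+ n.+1 * (y - x).
  rewrite -ler_pdivrMr// div1r; apply: le_trans (ltW (truncnS_gt _)) _.
  by rewrite -natrX ler_nat ltnW// ltn_expl.
apply: le_lt_trans (digit_spread_hi n.+1 x0) _.
apply: lt_le_trans (digit_spread_lo n.+1 y0).
rewrite ltr_pM2r ?invr_gt0 ?exprn_gt0//.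
apply: (@lt_le_trans _ _ (digits n.+1 x).+1%:R); first by rewrite -[ltRHS]natr1 ltrD2l; lra.
rewrite ler_nat; apply: spread_lt.
have p0 : 0 <= 2 ^+ n.+1 :> R by exact: exprn_ge0.
have /andP[t1 _] := truncn_itv (mulr_ge0 p0 x0).
by rewrite truncn_gt_nat -natr1; lra.
Qed.

(** Level [0] suffices: the head is at most [1] and the slack is [2^-1]. *)
Lemma digit_spread_itv x : 0 <= x <= 1 -> 0 <= digit_spread x <= 3 / 2.
Proof.
move=> /andP[x0 x1]; apply/andP; split.
  by apply: le_trans (digit_spread_lo 0 x0); rewrite divr_ge0// exprn_ge0.
apply: le_trans (digit_spread_hi 0 x0) _.
rewrite /digits_hi /digits expr0 divr1 mul1r /=.
suff : (Num.truncn x)%:R <= 1 :> R by lra.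
by rewrite (le_trans _ x1)// truncn_le.
Qed.

Definition spread_itv (a b : R) (n m : nat) : set R :=
  `[a + b * ((spread n m)%:R / 4 ^+ n),
    a + b * (((spread n m)%:R + 2^-1) / 4 ^+ n)]%classic.

(** The index [2 ^ n] is included because it is the truncation for [x = 1]. *)
Definition spread_cover (a b : R) (n : nat) : set R :=
  \big[setU/set0]_(m < (2 ^ n).+1) spread_itv a b n m.

Lemma measurable_spread_cover a b n : measurable (spread_cover a b n).
Proof. by apply: bigsetU_measurable => m _; exact: measurable_itv. Qed.

Lemma spread_coverP a b n x : 0 <= b -> 0 <= x <= 1 ->
  spread_cover a b n (a + b * digit_spread x).
Proof.
move=> b0 /andP[x0 x1]; rewrite /spread_cover -bigcup_mkord.
have tn : (Num.truncn (2 ^+ n * x) < (2 ^ n).+1)%N.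
  rewrite truncn_lt_nat ?mulr_ge0 ?exprn_ge0// -[ltRHS]natr1 natrX.
  by rewrite (@le_lt_trans _ _ (2 ^+ n))// ?ltrDl// ler_piMr// exprn_ge0.
exists (Num.truncn (2 ^+ n * x)) => //=.
rewrite /spread_itv/= in_itv/= !lerD2l; apply/andP; split; apply: ler_wpM2l => //.
- exact: (digit_spread_lo n x0).
- exact: (digit_spread_hi n x0).
Qed.

(** There are [2 ^ n + 1], hence at most [2 * 2 ^ n], intervals of length [b / (2 * 4 ^ n)]. *)
Lemma lebesgue_measure_spread_cover a b n : 0 < b ->
  ((@lebesgue_measure R) (spread_cover a b n) <= (b / 2 ^+ n)%:E)%E.
Proof.
move=> b0; have /le_trans := @Boole_inequality _ R _ (@lebesgue_measure R)
  (spread_itv a b n) (2 ^ n).+1 (fun m _ => measurable_itv _).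
apply => /=.
rewrite (eq_bigr (fun=> (b * (2^-1 / 4 ^+ n))%:E)); last first.
  move=> m _; rewrite /spread_itv lebesgue_measure_itv/= lte_fin ltrD2l ltr_pM2l//.
  rewrite ltr_pM2r ?invr_gt0 ?exprn_gt0// ltrDl invr_gt0 ltr0n/=.
  by rewrite -EFinB; congr (_%:E); ring.
rewrite sumEFin lee_fin sumr_const card_ord -[leLHS]mulr_natr -[(2 ^ n).+1%:R]natr1 natrX.
have -> : 4 ^+ n = 2 ^+ n * 2 ^+ n :> R by rewrite -exprMn -natrM.
have p1 : 1 <= 2 ^+ n :> R by rewrite exprn_ege1// ler1n.
set p := 2 ^+ n in p1 *; rewrite -mulrA ler_pM2l//.
have p0 : 0 < p by lra.
have -> : 2^-1 / (p * p) * (p + 1) = p^-1 * ((p + 1) / (2 * p)).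
  by field; rewrite gt_eqF.
rewrite ger_pMr ?invr_gt0// ler_pdivrMr ?mulr_gt0//; lra.
Qed.

Lemma digit_spread_null a b : 0 < b -> exists N : set R,
  [/\ measurable N, (@lebesgue_measure R) N = 0%E &
      forall x, 0 <= x <= 1 -> N (a + b * digit_spread x)].
Proof.
move=> b0; exists (\bigcap_n spread_cover a b n).
have mN : measurable (\bigcap_n spread_cover a b n).
  by apply: bigcap_measurable => // n _; exact: measurable_spread_cover.
split => //; last by move=> x x01 n _; apply: spread_coverP => //; exact: ltW.
apply/eqP; rewrite eq_le measure_ge0 andbT; apply/lee_addgt0Pr => e e0.
(* Then [b / e < n.+1 <= 2 ^+ n.+1], so the cover of level [n.+1] has measure at most [e]. *)
rewrite add0e; pose n := Num.truncn (b / e).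
apply: (@le_trans _ _ (lebesgue_measure (spread_cover a b n.+1))).
  apply: le_measure; rewrite ?inE//; first exact: measurable_spread_cover.
  exact: bigcap_inf.
apply: le_trans (lebesgue_measure_spread_cover a n.+1 b0) _.
rewrite lee_fin ler_pdivrMr ?exprn_gt0// mulrC -ler_pdivrMr//.
apply: le_trans (ltW (truncnS_gt _)) _.
by rewrite -natrX ler_nat ltnW// ltn_expl.
Qed.

End digit_spreading.

(** * The three jitters and the type of their grid laws *)

Section jitters.
Variable R : realType.
Implicit Types (u : R) (g : probability R R).

Definition point_jitter u : R := 1.

(** Adding [1] keeps the value positive; as [digit_spread] is at most [3 / 2] on [[0, 1]], dividing
    by [4] keeps it below [1]. *)
Definition cantor_jitter u : R := (1 + digit_spread (clip01 u)) / 4.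

(** Under [uniform01] its law is uniform on [[1/2, 1]], away from [0]. *)
Definition uniform_jitter u : R := (1 + clip01 u) / 2.

Let measurable_point_jitter : measurable_fun setT point_jitter.
Proof. exact: measurable_cst. Qed.

Let measurable_cantor_jitter : measurable_fun setT cantor_jitter.
Proof.
apply: nondecreasing_measurable => // u v uv.
rewrite ler_pM2r// lerD2l digit_spread_le ?clip01_le//.
by case/andP: (clip01_itv u).
Qed.

Let measurable_uniform_jitter : measurable_fun setT uniform_jitter.
Proof.
by apply: nondecreasing_measurable => // u v uv; rewrite ler_pM2r// lerD2l clip01_le.
Qed.

HB.instance Definition _ := isMeasurableFun.Build _ _ _ _
  point_jitter measurable_point_jitter.
HB.instance Definition _ := isMeasurableFun.Build _ _ _ _
  cantor_jitter measurable_cantor_jitter.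
HB.instance Definition _ := isMeasurableFun.Build _ _ _ _
  uniform_jitter measurable_uniform_jitter.

Lemma point_jitter_itv u : 0 < point_jitter u <= 1.
Proof. by rewrite ltr01 lexx. Qed.

Lemma cantor_jitter_itv u : 0 < cantor_jitter u <= 1.
Proof.
have /andP[] := digit_spread_itv (clip01_itv u).
by rewrite /cantor_jitter => ? ?; apply/andP; split; lra.
Qed.

Lemma uniform_jitter_itv u : 0 < uniform_jitter u <= 1.
Proof.
have /andP[] := clip01_itv u.
by rewrite /uniform_jitter => ? ?; apply/andP; split; lra.
Qed.

Lemma discrete_grid_law n s g :
  discrete_measure (grid_law point_jitter n s g (uniform01 R)).
Proof.
pose S : set R := range (fun k : nat => s * ((k%:R + 1) / n%:R)).
have cS : countable S by exact: card_image_le.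
have mS : measurable S by exact: countable_measurable.
exists S; split => //; apply: grid_law_null; first exact: measurableC.
move=> k; rewrite (_ : [set _ | _] = set0) ?measure0//.
by apply/seteqP; split => // u /=; apply; exists k.
Qed.

Lemma singular_grid_law n s g : (0 < n)%N -> 0 < s ->
  singular_measure (grid_law cantor_jitter n s g (uniform01 R)).
Proof.
move=> n0 s0; have n0R : 0 < n%:R :> R by rewrite ltr0n.
have b0 : 0 < s / (4 * n%:R) by rewrite divr_gt0 ?mulr_gt0.
(* In cell [k] the grid point is [s * (k + 1/4) / n] plus [s / (4 * n)] times a value of
   [digit_spread]. *)
have [N NP] := choice (fun k : nat =>
  digit_spread_null (s * ((k%:R + 4^-1) / n%:R)) b0).
have mN : measurable (\bigcup_k N k).
  by apply: bigcupT_measurable => k; case: (NP k).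
exists (\bigcup_k N k); split => //.
  apply: measure_negligible => //; apply: negligible_bigcup => k.
  by case: (NP k) => mNk Nk0 _; exists (N k); split.
apply: grid_law_null; first exact: measurableC.
move=> k; rewrite (_ : [set _ | _] = set0) ?measure0//.
apply/seteqP; split => // u /=; apply; exists k => //.
have [_ _ /(_ _ (clip01_itv u))] := NP k; congr (N k _).
by rewrite /cantor_jitter; field; rewrite gt_eqF.
Qed.

(** Since [digit_spread] is injective on [[0, 1]], in each cell at most one [u] there reaches [x],
    and a point is Lebesgue-null. *)
Lemma no_atoms_grid_law n s g : (0 < n)%N -> 0 < s ->
  no_atoms (grid_law cantor_jitter n s g (uniform01 R)).
Proof.
move=> n0 s0 x; apply: grid_law_null => // k.
have n0R : 0 < n%:R :> R by rewrite ltr0n.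
set S := [set _ | _].
have mS : measurable S.
  rewrite -[S]setTI; have : measurable_fun setT
    (fun u => s * ((k%:R + cantor_jitter u) / n%:R)).
    apply: measurable_funM => //; apply: measurable_funM => //.
    exact: measurable_funD.
  by apply => //; exact: measurable_set1.
have [[v [v01 Sv]]|nS] := pselect (exists v, 0 <= v <= 1 /\ S v); last first.
  apply: (@uniform01_null _ _ set0) => // u u01 Su; apply: nS.
  by exists u.
apply: (@uniform01_null _ _ [set v]) => //; first exact: lebesgue_measure_set1.
move=> u u01; rewrite /S /= -Sv.
move=> /(mulfI (lt0r_neq0 s0))/(mulIf (lt0r_neq0 _)).
rewrite invr_gt0 => /(_ n0R)/addrI; rewrite /cantor_jitter.
have i4 : (4^-1 : R) != 0 by rewrite invr_eq0 pnatr_eq0.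
move=> /(mulIf i4)/addrI; rewrite !clip01_id// => uv.
have [u0 _] := andP u01; have [v0 _] := andP v01.
apply/eqP; rewrite eq_le !leNgt; apply/andP; split; apply/negP.
- by move=> /(digit_spread_lt v0); rewrite uv ltxx.
- by move=> /(digit_spread_lt u0); rewrite uv ltxx.
Qed.

Lemma abs_continuous_grid_law n s g : (0 < n)%N -> 0 < s ->
  abs_continuous (grid_law uniform_jitter n s g (uniform01 R)).
Proof.
move=> n0 s0; have n0R : 0 < n%:R :> R by rewrite ltr0n.
apply/null_content_dominatesP => A mA A0; apply: grid_law_null => // k.
have b0 : 0 < s / (2 * n%:R) by rewrite divr_gt0 ?mulr_gt0.
(* On [[0, 1]] the grid point in cell [k] is the affine function [a + s / (2 * n) * u]. *)
pose a : R := s * ((k%:R + 2^-1) / n%:R).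
apply: (@uniform01_null _ _ ((fun u => a + s / (2 * n%:R) * u) @^-1` A)).
- rewrite -[X in measurable X]setTI.
  have : measurable_fun setT (fun u => s * ((k%:R + uniform_jitter u) / n%:R)).
    apply: measurable_funM => //; apply: measurable_funM => //.
    exact: measurable_funD.
  exact.
- rewrite -[X in measurable X]setTI.
  have : measurable_fun setT (fun u => a + s / (2 * n%:R) * u).
    by apply: measurable_funD => //; exact: measurable_funM.
  exact.
- exact: lebesgue_measure_affine_preimage.
- move=> u u01 /=; congr (A _); rewrite /uniform_jitter clip01_id// /a.
  by field; rewrite gt_eqF.
Qed.

End jitters.

Theorem theoremB2 (R : realType) (d : nat) (g : probability R R) :
  (3 <= d)%N -> PWd d g ->
  (exists g1 : nat -> probability R R,
      (forall n, PWd d (g1 n) /\ discrete_measure (g1 n)) /\ weak_cvg_nonneg g1 g) /\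
  (exists g2 : nat -> probability R R,
      (forall n, [/\ PWd d (g2 n), singular_measure (g2 n) & no_atoms (g2 n)])
      /\ weak_cvg_nonneg g2 g) /\
  (exists g3 : nat -> probability R R,
      (forall n, PWd d (g3 n) /\ abs_continuous (g3 n)) /\ weak_cvg_nonneg g3 g).
Proof.
move=> /ltnW d1 gW.
have approx (U : {mfun R >-> R}) (U01 : forall x, 0 < U x <= 1) :=
  grid_law_approximation (uniform01 R) U01 d1 gW.
split; [|split].
- have [ns [n0 s0 nsW ns_cvg]] := approx _ (@point_jitter_itv R).
  exists (fun m => grid_law (@point_jitter R) (ns m).1 (ns m).2 g (uniform01 R)).
  by split => // m; split => //; exact: discrete_grid_law.
- have [ns [n0 s0 nsW ns_cvg]] := approx _ (@cantor_jitter_itv R).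
  exists (fun m => grid_law (@cantor_jitter R) (ns m).1 (ns m).2 g (uniform01 R)).
  split => // m; split => //; first exact: singular_grid_law.
  exact: no_atoms_grid_law.
- have [ns [n0 s0 nsW ns_cvg]] := approx _ (@uniform_jitter_itv R).
  exists (fun m => grid_law (@uniform_jitter R) (ns m).1 (ns m).2 g (uniform01 R)).
  by split => // m; split => //; exact: abs_continuous_grid_law.
Qed.
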